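(* Let $n\ge1$, $\mathcal{F}:=\{x\in\mathbb{R}^n:\ x\ge0,\ \|x\|\le1\}$, and let $\mathcal{G}$ be the closed convex hull of $\{(x,xx^T):x\in\mathcal{F}\}$. Let $(I,J)$ be a partition of the index set $\{1,\dots,n\}$ (either part may be empty), and define $$\mathcal{D}_{IJ}:=\{(x,X):\ [Xe-x]_I\ge0,\ [Xe-x]_J\le0\}.$$ Then the following constraints hold for every $(x,X)\in\mathcal{G}\cap\mathcal{D}_{IJ}$: $$\mathrm{tr}(X)\le1-\|[Xe-x]_J\|,\qquad \mathrm{tr}(X)\le e^Tx-\|[Xe-x]_I\|.$$ Moreover, on $\mathcal{D}_{IJ}$ these two constraints imply all of the slab inequalities: for every $s\in\mathbb{R}^n$ with $\|s\|=1$ and $s\ge0$, every $(x,X)\in\mathcal{D}_{IJ}$ satisfying the two constraints above also satisfies $$\mathrm{tr}(X)\le1+s^T(Xe-x)\qquad\text{and}\qquad \mathrm{tr}(X)\le e^Tx-s^T(Xe-x).$$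
   Context: $\|\cdot\|$ is the Euclidean norm, $e\in\mathbb{R}^n$ is the all-ones vector, and vector inequalities are componentwise. The pairs $(x,X)$ have $x\in\mathbb{R}^n$ and $X$ a symmetric $n\times n$ real matrix. For a vector $y$ and index set $I$, $[y]_I$ (or $y_I$) denotes the subvector of entries indexed by $I$; the norm of an empty subvector is $0$. The two slab inequalities are those associated with the slab $0\le s^Tx\le1$, which is valid for $\mathcal{F}$ when $s\ge0$ and $\|s\|=1$. *)

(* Defs.v *)
From HB Require Import structures.
From mathcomp Require Import all_boot all_order all_algebra.
From mathcomp Require Import all_classical all_reals.
From mathcomp Require Import topology normedtype convex.

Set Implicit Arguments.
Unset Strict Implicit.
Unset Printing Implicit Defensive.

Import Order.TTheory GRing.Theory Num.Theory.
Import numFieldNormedType.Exports.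

Local Open Scope classical_set_scope.
Local Open Scope ring_scope.

(* The norm that the library puts on ['cV[R]_n] is the maximum norm. *)
Definition enorm (R : realType) (n : nat) (u : 'cV[R]_n) : R :=
  Num.sqrt (\sum_(i < n) u i 0 ^+ 2).

Definition dot (R : realType) (n : nat) (u v : 'cV[R]_n) : R :=
  (u^T *m v) 0 0.

Definition ones (R : realType) (n : nat) : 'cV[R]_n := const_mx 1.

Definition cwle (R : realType) (n : nat) (u v : 'cV[R]_n) : Prop :=
  forall i, u i 0 <= v i 0.

Definition subvec (R : realType) (n : nat) (I : {set 'I_n}) (y : 'cV[R]_n) :
    'cV[R]_#|I| :=
  rowsub (fun k : 'I_#|I| => enum_val k) y.

Definition feas (R : realType) (n : nat) : set 'cV[R]_n :=
  [set x | cwle 0 x /\ enorm x <= 1].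
Arguments feas R n : clear implicits.

Definition lifted (R : realType) (n : nat) : set ('cV[R]_n * 'M[R]_n) :=
  [set (x, x *m x^T) | x in feas R n].
Arguments lifted R n : clear implicits.

(* The product topology used by [closed] is the usual topology of the
   finite-dimensional space of pairs. Symmetric [X] form a closed subspace, so
   it does not matter that the hull is taken among all square matrices. *)
Definition closed_convex_hull (R : realType) (n : nat)
    (A : set ('cV[R]_n * 'M[R]_n)) : set ('cV[R]_n * 'M[R]_n) :=
  smallest [set B : set ('cV[R]_n * 'M[R]_n) | closed B /\ convex_set B] A.

Definition Gset (R : realType) (n : nat) : set ('cV[R]_n * 'M[R]_n) :=
  closed_convex_hull (lifted R n).
Arguments Gset R n : clear implicits.

Definition Dset (R : realType) (n : nat) (I J : {set 'I_n}) :
    set ('cV[R]_n * 'M[R]_n) :=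
  [set p | [/\ p.2^T = p.2,
               cwle 0 (subvec I (p.2 *m ones R n - p.1)) &
               cwle (subvec J (p.2 *m ones R n - p.1)) 0]].

(* Main.v *)
(** Both slab inequalities are affine in (x, X), so they pass from the points
    (x, x x^T) to the closed convex hull, for every s >= 0 with |s| <= 1. On
    D_IJ, with y = X e - x, the maximum of s^T y over these s is |y_I| and its
    minimum is - |y_J|. The extremal choices of s give the two norm
    constraints, and the extremal bounds give back all slab inequalities. *)

Require Import Defs.
From HB Require Import structures.
From mathcomp Require Import all_boot all_order all_algebra.
From mathcomp Require Import all_classical all_reals.
From mathcomp Require Import topology normedtype convex.
From mathcomp Require Import unstable interval_inference ring lra.

Set Implicit Arguments.
Unset Strict Implicit.
Unset Printing Implicit Defensive.

Import Order.TTheory GRing.Theory Num.Theory.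
Import numFieldNormedType.Exports.

Local Open Scope ring_scope.

(** * Cauchy-Schwarz for finite sums *)

Lemma sum_sqr_ge0 (R : realType) (T : finType) (P : pred T) (u : T -> R) :
  0 <= \sum_(i | P i) u i ^+ 2.
Proof. by apply: sumr_ge0 => i _; exact: sqr_ge0. Qed.

(* Lagrange's identity:
   sum_(i, j) (u_i v_j - u_j v_i)^2 = 2 (|u|^2 |v|^2 - <u, v>^2). *)
Lemma cauchy_schwarz_sum (R : realType) (T : finType) (P : pred T)
    (u v : T -> R) :
  (\sum_(i | P i) u i * v i) ^+ 2 <=
  (\sum_(i | P i) u i ^+ 2) * (\sum_(i | P i) v i ^+ 2).
Proof.
set C := \sum_(i | P i) u i * v i; set A := \sum_(i | P i) u i ^+ 2.
set B := \sum_(i | P i) v i ^+ 2.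
have : 0 <= \sum_(i | P i) \sum_(j | P j) (u i * v j - u j * v i) ^+ 2.
  by apply: sumr_ge0 => i _; exact: sum_sqr_ge0.
rewrite (eq_bigr (fun i => u i ^+ 2 * B + v i ^+ 2 * A - 2 * (u i * v i) * C)).
  by rewrite sumrB big_split -!mulr_suml -mulr_sumr /= -/A -/B -/C; nra.
move=> i _; rewrite (eq_bigr (fun j => u i ^+ 2 * v j ^+ 2 + v i ^+ 2 * u j ^+ 2
  - 2 * (u i * v i) * (u j * v j))); last by move=> j _; ring.
by rewrite sumrB big_split -!mulr_sumr.
Qed.

(** * Subvectors, their norms, and the extremal values of s^T y *)

Lemma dotE (R : realType) (n : nat) (u v : 'cV[R]_n) :
  dot u v = \sum_i u i 0 * v i 0.
Proof. by rewrite /dot mxE; apply: eq_bigr => i _; rewrite mxE. Qed.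

Lemma enorm_subvec (R : realType) (n : nat) (I : {set 'I_n}) (y : 'cV[R]_n) :
  enorm (subvec I y) = Num.sqrt (\sum_(i in I) y i 0 ^+ 2).
Proof.
rewrite /enorm [in RHS]big_enum_val /=; congr Num.sqrt.
by apply: eq_bigr => k _; rewrite mxE.
Qed.

Lemma cwle_subvecP (R : realType) (n : nat) (I : {set 'I_n})
    (y z : 'cV[R]_n) :
  cwle (subvec I y) (subvec I z) <-> {in I, forall i, y i 0 <= z i 0}.
Proof.
split=> [yz i iI|yz k]; last by rewrite !mxE; exact/yz/enum_valP.
by have := yz (enum_rank_in iI i); rewrite !mxE enum_rankK_in.
Qed.

Lemma subvec0 (R : realType) (n : nat) (I : {set 'I_n}) :
  subvec I (0 : 'cV[R]_n) = 0.
Proof. by apply/matrixP => i j; rewrite !mxE. Qed.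

Lemma subvecN (R : realType) (n : nat) (I : {set 'I_n}) (y : 'cV[R]_n) :
  subvec I (- y) = - subvec I y.
Proof. by apply/matrixP => i j; rewrite !mxE. Qed.

Lemma enormN (R : realType) (n : nat) (y : 'cV[R]_n) : enorm (- y) = enorm y.
Proof.
by rewrite /enorm; congr Num.sqrt; apply: eq_bigr => i _; rewrite mxE sqrrN.
Qed.

Lemma enorm_le1 (R : realType) (n : nat) (y : 'cV[R]_n) :
  (enorm y <= 1) = (\sum_i y i 0 ^+ 2 <= 1).
Proof. by rewrite /enorm -{1}sqrtr1 ler_sqrt. Qed.

Lemma dot_le_enorm_subvec (R : realType) (n : nat) (I : {set 'I_n})
    (s y : 'cV[R]_n) :
  cwle 0 s -> enorm s <= 1 -> {in ~: I, forall i, y i 0 <= 0} ->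
  dot s y <= enorm (subvec I y).
Proof.
move=> s0 s1 yI; have {}s0 i : 0 <= s i 0 by have := s0 i; rewrite mxE.
rewrite enorm_le1 in s1.
have le_sI : \sum_(i in I) s i 0 ^+ 2 <= 1.
  apply: le_trans s1; rewrite [leRHS](bigID (mem I)) /= lerDl.
  exact: sum_sqr_ge0.
rewrite dotE (bigID (mem I)) /= enorm_subvec.
apply: (@le_trans _ _ (\sum_(i in I) s i 0 * y i 0)).
  rewrite gerDl; apply: sumr_le0 => i iI.
  by rewrite mulr_ge0_le0 // yI // inE.
apply: le_trans (ler_norm _) _; rewrite -sqrtr_sqr ler_sqrt ?sum_sqr_ge0 //.
apply: le_trans (cauchy_schwarz_sum _ _ _) _.
by rewrite ler_piMl ?sum_sqr_ge0.
Qed.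

(** The maximizer is y_I / |y_I|, extended by zero outside [I]. The condition is |s| <= 1 rather
    than |s| = 1 so that s = 0 is admissible when y_I = 0 or [I] is empty. *)
Lemma enorm_subvec_attained (R : realType) (n : nat) (I : {set 'I_n})
    (y : 'cV[R]_n) : {in I, forall i, 0 <= y i 0} ->
  exists s : 'cV[R]_n,
    [/\ cwle 0 s, enorm s <= 1 & dot s y = enorm (subvec I y)].
Proof.
move=> yI; set m := enorm (subvec I y).
have m2 : m ^+ 2 = \sum_(i in I) y i 0 ^+ 2.
  by rewrite /m enorm_subvec sqr_sqrtr ?sum_sqr_ge0.
have m0 : 0 <= m by exact: sqrtr_ge0.
(* If m = 0 then m^-1 = 0 and s = 0, which also works. *)
exists (\col_i (if i \in I then m^-1 * y i 0 else 0)); split.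
- move=> i; rewrite !mxE; case: ifP => // /yI yi0.
  by rewrite mulr_ge0 ?invr_ge0.
- rewrite enorm_le1; under eq_bigr => i _ do rewrite mxE.
  rewrite (eq_bigr (fun i => if i \in I then (m^-1 * y i 0) ^+ 2 else 0));
    last by move=> i _; case: ifP => // _; rewrite expr0n.
  rewrite -big_mkcond; under eq_bigr do rewrite exprMn.
  rewrite -mulr_sumr -m2 -exprMn.
  have [->|mN0] := eqVneq m 0; first by rewrite mulr0 expr0n.
  by rewrite mulVf // expr1n.
- rewrite dotE.
  rewrite (eq_bigr (fun i => if i \in I then m^-1 * y i 0 ^+ 2 else 0)).
    rewrite -big_mkcond -mulr_sumr -m2.
    have [->|mN0] := eqVneq m 0; first by rewrite expr0n mulr0.
    by rewrite expr2 mulKf.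
  by move=> i _; rewrite mxE; case: ifP => _; rewrite ?mul0r // -mulrA expr2.
Qed.

(** * Continuity of linear functionals, and half-spaces containing the hull *)

Lemma continuous_sum (R : realType) (T : topologicalType) (I : finType)
    (f : I -> T -> R) :
  (forall i, continuous (f i)) -> continuous (fun t => \sum_i f i t).
Proof.
move=> fc; rewrite (_ : (fun t => _) = \sum_i f i); last first.
  by apply/funext => t; rewrite fct_sumE.
elim/big_ind: _ => // [t|g h gc hc t]; first exact: cvg_cst.
exact: continuousD (gc t) (hc t).
Qed.

(** The trace is a finite sum of scaled entries of [X]. Rectangular shapes are allowed so that [B]
    can also be a row a^T, which covers [dot a]. *)
Lemma mxtrace_mulmx_continuous (R : realType) (m n : nat) (B : 'M[R]_(m, n)) :
  continuous (fun X : 'M[R]_(n, m) => \tr (B *m X)).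
Proof.
rewrite (_ : (fun _ => _) =
  fun X : 'M[R]_(n, m) => \sum_i \sum_k B i k * X k i); last first.
  by apply/funext => X; apply: eq_bigr => i _; rewrite mxE.
apply: continuous_sum => i; apply: continuous_sum => k X.
apply: (continuous_comp (@coord_continuous _ _ _ k i X)).
exact: mulrl_continuous.
Qed.

Lemma dot_mxtrace (R : realType) (n : nat) (u v : 'cV[R]_n) :
  dot u v = \tr (u^T *m v).
Proof. by rewrite /dot /mxtrace big_ord1. Qed.

Lemma dot_continuous (R : realType) (n : nat) (a : 'cV[R]_n) :
  continuous (dot a).
Proof.
rewrite (_ : dot a = fun z => \tr (a^T *m z)).
  exact: mxtrace_mulmx_continuous.
by apply/funext => z; rewrite dot_mxtrace.
Qed.

(** The half-space where the affine function is nonnegative is closed, convex and contains the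
    lifted points, so it is one of the sets whose intersection is the hull. *)
Lemma Gset_halfspace (R : realType) (n : nat) (c : R) (a : 'cV[R]_n)
    (B : 'M[R]_n) :
  (forall x, feas R n x -> 0 <= c + dot a x + \tr (B *m (x *m x^T))) ->
  forall x X, Gset R n (x, X) -> 0 <= c + dot a x + \tr (B *m X).
Proof.
move=> H x X; pose f (p : 'cV[R]_n * 'M[R]_n) : R :=
  c + dot a p.1 + \tr (B *m p.2).
move=> /(_ (f @^-1` [set r | 0 <= r])%classic); apply; split; last first.
  by move=> _ [z zF <-]; exact: H.
split.
  apply: preimage_closed; last exact: closed_ge.
  move=> p _; apply: cvgD; last first.
    apply: (@continuous_comp _ _ _ snd (fun Y => \tr (B *m Y))).
      exact: cvg_snd.
    exact: mxtrace_mulmx_continuous.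
  apply: cvgD; first exact: cvg_cst.
  apply: (@continuous_comp _ _ _ fst (dot a)); first exact: cvg_fst.
  exact: dot_continuous.
move=> p q t; rewrite !inE /= => fp fq.
have -> : f (conv t p q) = t%:num * f p + (1 - t%:num) * f q.
  rewrite /f /= !dot_mxtrace !mulmxDr -!scalemxAr !mxtraceD !mxtraceZ /onem.
  by ring.
by rewrite addr_ge0 ?mulr_ge0 ?subr_ge0.
Qed.

(** * Bilinearity of [dot], and the slab inequalities on the hull *)

Lemma dot_mulmx_mxtrace (R : realType) (n : nat) (s e : 'cV[R]_n)
    (X : 'M[R]_n) : dot s (X *m e) = \tr (e *m s^T *m X).
Proof. by rewrite dot_mxtrace mulmxA mxtrace_mulC mulmxA. Qed.

Lemma dotDl (R : realType) (n : nat) (u v s : 'cV[R]_n) :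
  dot (u + v) s = dot u s + dot v s.
Proof. by rewrite !dot_mxtrace linearD mulmxDl raddfD. Qed.

Lemma dotNl (R : realType) (n : nat) (u s : 'cV[R]_n) :
  dot (- u) s = - dot u s.
Proof. by rewrite !dot_mxtrace linearN mulNmx raddfN. Qed.

Lemma dotBr (R : realType) (n : nat) (s u v : 'cV[R]_n) :
  dot s (u - v) = dot s u - dot s v.
Proof. by rewrite !dot_mxtrace mulmxBr raddfB. Qed.

Lemma dotNr (R : realType) (n : nat) (s u : 'cV[R]_n) :
  dot s (- u) = - dot s u.
Proof. by rewrite !dot_mxtrace mulmxN raddfN. Qed.

Lemma dotC (R : realType) (n : nat) (u v : 'cV[R]_n) : dot u v = dot v u.
Proof. by rewrite !dotE; apply: eq_bigr => i _; rewrite mulrC. Qed.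

(* With t := s^T x in [0, 1], both inequalities at (x, x x^T) bound |x|^2 by a
   convex combination of 1 and e^T x, each of which is at least |x|^2. *)
Lemma slab_lifted (R : realType) (n : nat) (s x : 'cV[R]_n) :
  cwle 0 s -> enorm s <= 1 -> feas R n x ->
  \tr (x *m x^T) <= 1 + dot s x * (dot (ones R n) x - 1) /\
  \tr (x *m x^T) <= dot (ones R n) x - dot s x * (dot (ones R n) x - 1).
Proof.
move=> s0 s1 [x0 x1].
have {}s0 i : 0 <= s i 0 by have := s0 i; rewrite mxE.
have {}x0 i : 0 <= x i 0 by have := x0 i; rewrite mxE.
rewrite !enorm_le1 in s1 x1.
have -> : \tr (x *m x^T) = \sum_i x i 0 ^+ 2.
  by rewrite mxtrace_mulC -dot_mxtrace dotE.
(* Each x_i lies in [0, 1] because x_i^2 <= |x|^2 <= 1; hence x_i^2 <= x_i. *)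
have le_ex : \sum_i x i 0 ^+ 2 <= dot (ones R n) x.
  rewrite dotE; apply: ler_sum => i _; rewrite mxE mul1r expr2 ler_piMl //.
  rewrite -(@expr_le1 _ 2) //; apply: le_trans x1.
  by rewrite (bigD1 i) //= lerDl sum_sqr_ge0.
have t0 : 0 <= dot s x.
  by rewrite dotE; apply: sumr_ge0 => i _; rewrite mulr_ge0.
have t1 : dot s x <= 1.
  rewrite -(@expr_le1 _ 2) // dotE.
  apply: le_trans (cauchy_schwarz_sum _ _ _) _.
  by rewrite mulr_ile1 ?sum_sqr_ge0.
by split; nra.
Qed.

Lemma slab_Gset (R : realType) (n : nat) (s x : 'cV[R]_n) (X : 'M[R]_n) :
  cwle 0 s -> enorm s <= 1 -> Gset R n (x, X) ->
  \tr X <= 1 + dot s (X *m ones R n - x) /\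
  \tr X <= dot (ones R n) x - dot s (X *m ones R n - x).
Proof.
move=> s0 s1 xX; set e := ones R n.
(* At X = z z^T, s^T X e factors as (s^T z)(e^T z), so s^T (X e - z) becomes the product s^T z (e^T
   z - 1) of [slab_lifted]. *)
have lift z : \tr (e *m s^T *m (z *m z^T)) = dot s z * dot e z.
  rewrite -dot_mulmx_mxtrace /dot !mulmxA -mulmxA mxE big_ord1.
  by congr (_ * _); exact: dotC.
have trB (A B : 'M[R]_n) : \tr (A - B) = \tr A - \tr B by exact: raddfB.
have trN (A : 'M[R]_n) : \tr (- A) = - \tr A by exact: raddfN.
have simp := (dotBr, dotDl, dotNl, mulmxBl, mulNmx, mul1mx,
  trB, trN, dot_mulmx_mxtrace).
split.
(* Since s^T X e = tr(e s^T X), the slab inequality is affine with a = - s and B = e s^T - 1; the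
   second one below is treated alike. *)
- suff : 0 <= 1 + dot (- s) x + \tr ((e *m s^T - 1%:M) *m X).
    by rewrite !simp; lra.
  apply: (Gset_halfspace _ xX) => z /(slab_lifted s0 s1)[+ _].
  by rewrite !simp lift -/e; lra.
- suff : 0 <= 0 + dot (e + s) x + \tr ((- e *m s^T - 1%:M) *m X).
    by rewrite !simp; lra.
  apply: (Gset_halfspace _ xX) => z /(slab_lifted s0 s1)[_ +].
  by rewrite !simp lift -/e; lra.
Qed.

Theorem theorem3 (R : realType) (n : nat) (hn : (1 <= n)%N)
    (I J : {set 'I_n}) (hIJ : I :|: J = [set: 'I_n]%SET)
    (hdisj : [disjoint I & J]) :
  (forall (x : 'cV[R]_n) (X : 'M[R]_n),
      (Gset R n `&` Dset I J)%classic (x, X) ->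
      \tr X <= 1 - enorm (subvec J (X *m ones R n - x)) /\
      \tr X <= dot (ones R n) x - enorm (subvec I (X *m ones R n - x)))
  /\
  (forall s : 'cV[R]_n, enorm s = 1 -> cwle 0 s ->
    forall (x : 'cV[R]_n) (X : 'M[R]_n),
      Dset I J (x, X) ->
      \tr X <= 1 - enorm (subvec J (X *m ones R n - x)) ->
      \tr X <= dot (ones R n) x - enorm (subvec I (X *m ones R n - x)) ->
      \tr X <= 1 + dot s (X *m ones R n - x) /\
      \tr X <= dot (ones R n) x - dot s (X *m ones R n - x)).
Proof.
have hJ : I = ~: J.
  apply/setP => i; rewrite inE; apply/idP/idP => [iI|iJ].
    by rewrite (disjointFr hdisj).
  have : i \in I :|: J by rewrite hIJ inE.
  by rewrite inE (negPf iJ) orbF.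
have sgn x X : Dset I J (x, X) ->
    {in I, forall i, 0 <= (X *m ones R n - x) i 0} /\
    {in J, forall i, 0 <= (- (X *m ones R n - x)) i 0}.
  case=> _; rewrite -(subvec0 R I) -(subvec0 R J) => /cwle_subvecP yI.
  move=> /cwle_subvecP yJ; split=> i => [/yI|/yJ]; first by rewrite mxE.
  by rewrite !mxE oppr_ge0.
split=> [x X [xG /sgn[yI yJ]]|s s1 s0 x X /sgn[yI yJ] hJx hIx].
(* With y = X e - x, [s] attains s^T (- y) = |y_J| and serves the first bound; [t] attains t^T y =
   |y_I| and serves the second. *)
- have [s [s0 s1 sE]] := enorm_subvec_attained yJ.
  have [t [t0 t1 tE]] := enorm_subvec_attained yI.
  have [+ _] := slab_Gset s0 s1 xG; have [_] := slab_Gset t0 t1 xG.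
  by rewrite tE -[dot s _]opprK -dotNr sE subvecN enormN.
- have le1 : enorm s <= 1 by rewrite s1.
  (* Outside [J], that is on [I], - y is nonpositive, so - s^T y <= |y_J|; symmetrically s^T y <=
     |y_I|. *)
  have sJ : dot s (- (X *m ones R n - x)) <=
      enorm (subvec J (- (X *m ones R n - x))).
    apply: dot_le_enorm_subvec => // i; rewrite -hJ => /yI yi0.
    by rewrite [leLHS]mxE oppr_le0.
  have sI : dot s (X *m ones R n - x) <= enorm (subvec I (X *m ones R n - x)).
    apply: dot_le_enorm_subvec => // i; rewrite hJ finset.setCK => /yJ.
    by rewrite [leRHS]mxE oppr_ge0.
  rewrite dotNr subvecN enormN in sJ.
  by split; lra.
Qed.
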